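(* $\mathrm{LDer}(L_1)=\mathrm{BLDer}(L_1)=\mathrm{Der}(L_1)$; that is, for linear maps $L_1\to L_1$, the local derivations, the ($\mathbb{F}$-linear) 2-local derivations, and the derivations coincide.
   Context: The ground field $\mathbb{F}$ is algebraically closed of characteristic zero. $L_1$ is the $\mathbb{N}$-graded Lie algebra over $\mathbb{F}$ with basis $\{e_i\mid i\geq 1\}$, $e_i$ homogeneous of degree $i$, and brackets $[e_i,e_j]=(j-i)e_{i+j}$ for all $i,j\geq 1$. For a Lie algebra $\mathfrak{g}$: a derivation is a linear map $D:\mathfrak{g}\to\mathfrak{g}$ with $D([x,y])=[D(x),y]+[x,D(y)]$ for all $x,y\in\mathfrak{g}$; $\mathrm{Der}(\mathfrak{g})$ is the set of derivations. A local derivation is a linear map $\Delta:\mathfrak{g}\to\mathfrak{g}$ such that for every $x\in\mathfrak{g}$ there is a derivation $D_x$ of $\mathfrak{g}$ (depending on $x$) with $\Delta(x)=D_x(x)$; $\mathrm{LDer}(\mathfrak{g})$ is the set of local derivations. A 2-local derivation is here a linear map $\Delta:\mathfrak{g}\to\mathfrak{g}$ such that for every $x,y\in\mathfrak{g}$ there is a derivation $D_{x,y}$ of $\mathfrak{g}$ (depending on $x,y$) with $\Delta(x)=D_{x,y}(x)$ and $\Delta(y)=D_{x,y}(y)$; $\mathrm{BLDer}(\mathfrak{g})$ is the set of 2-local derivations (linearity is part of the definition). *)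

(* Defs.v *)
From HB Require Import structures.
From mathcomp Require Import all_boot all_order all_algebra.
From mathcomp Require Import ring.
From mathcomp Require Import boolp classical_sets.

Set Implicit Arguments.
Unset Strict Implicit.
Unset Printing Implicit Defensive.

Import GRing.Theory.
Local Open Scope ring_scope.

HB.mixin Record Lmodule_isLieAlgebra (F : fieldType) L of GRing.Lmodule F L := {
  lie : L -> L -> L;
  lie_linearl : forall z, linear (lie^~ z);
  lie_linearr : forall z, linear (lie z);
  liexx : forall x, lie x x = 0;
  lie_jacobi : forall x y z,
    lie x (lie y z) + lie y (lie z x) + lie z (lie x y) = 0
}.

#[short(type="lieAlgType")]
HB.structure Definition LieAlgebra (F : fieldType) :=
  { L of GRing.Lmodule F L & Lmodule_isLieAlgebra F L }.

Definition is_derivation (F : fieldType) (L : lieAlgType F)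
    (D : {linear L -> L}) : Prop :=
  forall x y, D (lie x y) = lie (D x) y + lie x (D y).

Definition is_local_derivation (F : fieldType) (L : lieAlgType F)
    (Delta : {linear L -> L}) : Prop :=
  forall x, exists D : {linear L -> L}, is_derivation D /\ Delta x = D x.

Definition is_2local_derivation (F : fieldType) (L : lieAlgType F)
    (Delta : {linear L -> L}) : Prop :=
  forall x y, exists D : {linear L -> L},
    [/\ is_derivation D, Delta x = D x & Delta y = D y].

Definition Der (F : fieldType) (L : lieAlgType F) : set {linear L -> L} :=
  [set D | is_derivation D]%classic.
Arguments Der {F} L.

Definition LDer (F : fieldType) (L : lieAlgType F) : set {linear L -> L} :=
  [set Delta | is_local_derivation Delta]%classic.
Arguments LDer {F} L.

Definition BLDer (F : fieldType) (L : lieAlgType F) : set {linear L -> L} :=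
  [set Delta | is_2local_derivation Delta]%classic.
Arguments BLDer {F} L.

(* L_1 is carried by the vector space of polynomials, the monomial 'X^k       *)
(* standing for the basis vector e_(k+1); the ring structure of {poly F} is   *)
(* not part of L_1.                                                           *)
Definition L1 (F : fieldType) : Type := {poly F}.

HB.instance Definition _ (F : fieldType) := GRing.Lmodule.copy (L1 F) {poly F}.

(* e_i, meaningful only for i >= 1 (e 0 is a junk value equal to e 1). *)
Definition L1e (F : fieldType) (i : nat) : L1 F := 'X^(i.-1).

(* The bilinear extension of [e_i, e_j] = (j - i) e_(i + j), with the basis   *)
(* indices shifted by one: the i-th coefficient is the coordinate on e_(i+1). *)
Definition L1bracket (F : fieldType) (p q : L1 F) : L1 F :=
  \sum_(i < size (p : {poly F})) \sum_(j < size (q : {poly F}))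
    ((p : {poly F})`_i * (q : {poly F})`_j * (j.+1%:R - i.+1%:R))
      *: L1e F (i.+1 + j.+1).

Lemma L1bracketXn (F : fieldType) (i j : nat) :
  (j.+1%:R - i.+1%:R) *: L1e F (i.+1 + j.+1) =
    'X^2 * ('X^i * ('X^j)^`() - ('X^i)^`() * 'X^j) :> {poly F}.
Proof.
rewrite /L1e -!natr1 opprD addrACA subrr addr0 addSn addnS /= !derivXn scalerBl.
rewrite !scaler_nat mulrBr !mulrnAr !mulrnAl mulrnAr.
congr (_ - _).
  case: j => [|j]; rewrite ?mulr0n //.
  by rewrite mulrA -!exprD; congr (_ ^+ _ *+ _); rewrite /= addnS !addSn.
case: i => [|i]; rewrite ?mulr0n //.
by rewrite mulrA -!exprD.
Qed.

(* The bracket of the vector fields p(t) t^2 d/dt, with e_i = t^(i+1) d/dt. *)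
Lemma L1bracketE (F : fieldType) (p q : {poly F}) :
  L1bracket p q = 'X^2 * (p * q^`() - p^`() * q) :> {poly F}.
Proof.
have D (r : {poly F}) : r = \sum_(i < size r) r`_i *: 'X^i.
  by rewrite -[LHS]coefK poly_def.
have D' (r : {poly F}) : r^`() = \sum_(i < size r) r`_i *: ('X^i)^`().
  rewrite {1}(D r) raddf_sum /=; apply: eq_bigr => i _.
  by rewrite derivZ.
have -> : p * q^`() - p^`() * q =
    (\sum_(i < size p) p`_i *: 'X^i) * (\sum_(j < size q) q`_j *: ('X^j)^`())
    - (\sum_(i < size p) p`_i *: ('X^i)^`()) * (\sum_(j < size q) q`_j *: 'X^j).
  by rewrite -!D' -!D.
rewrite /L1bracket !big_distrlr -sumrB big_distrr; apply: eq_bigr => i _ /=.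
rewrite -sumrB big_distrr; apply: eq_bigr => j _ /=.
rewrite /L1e /= -[LHS]scalerA [X in _ *: X]L1bracketXn.
by rewrite -!mul_polyC polyCM; ring.
Qed.

Lemma L1bracket_linearl (F : fieldType) (z : L1 F) :
  linear (fun x : L1 F => L1bracket x z).
Proof.
move=> a x y; rewrite !L1bracketE derivD derivZ -!mul_polyC.
ring.
Qed.

Lemma L1bracket_linearr (F : fieldType) (z : L1 F) : linear (L1bracket z).
Proof.
move=> a x y; rewrite !L1bracketE derivD derivZ -!mul_polyC.
ring.
Qed.

Lemma L1bracketxx (F : fieldType) (x : L1 F) : L1bracket x x = 0.
Proof. by rewrite L1bracketE; ring. Qed.

Lemma L1bracket_jacobi (F : fieldType) (x y z : L1 F) :
  L1bracket x (L1bracket y z) + L1bracket y (L1bracket z x)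
    + L1bracket z (L1bracket x y) = 0.
Proof.
by rewrite !L1bracketE !(derivM, derivB, derivX); ring.
Qed.

HB.instance Definition _ (F : fieldType) :=
  Lmodule_isLieAlgebra.Build F (L1 F) (@L1bracket_linearl F)
    (@L1bracket_linearr F) (@L1bracketxx F) (@L1bracket_jacobi F).

Lemma L1_lie_e (F : fieldType) (i j : nat) : (0 < i)%N -> (0 < j)%N ->
  lie (L1e F i) (L1e F j) = (j%:R - i%:R) *: L1e F (i + j).
Proof.
case: i j => [|i] [|j] // _ _.
by rewrite [RHS]L1bracketXn [LHS]L1bracketE.
Qed.

Lemma L1e_span (F : fieldType) (x : L1 F) :
  exists (n : nat) (c : nat -> F), x = \sum_(1 <= i < n.+1) c i *: L1e F i.
Proof.
exists (size (x : {poly F})), (fun i => (x : {poly F})`_i.-1).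
by rewrite big_add1 /= big_mkord -[LHS](coefK (x : {poly F})) poly_def.
Qed.

Lemma L1e_free (F : fieldType) (n : nat) (c : nat -> F) :
  \sum_(1 <= i < n.+1) c i *: L1e F i = 0 ->
  forall i, (1 <= i <= n)%N -> c i = 0.
Proof.
rewrite big_add1 /= big_mkord => c0 [|i] //= lt_in.
have := congr1 (fun p : {poly F} => p`_i) c0.
by rewrite -(poly_def n (fun i => c i.+1)) coef_poly coef0 lt_in.
Qed.

(* Main.v *)
From HB Require Import structures.
Require Import Defs.
From mathcomp Require Import all_boot all_order all_algebra.
From mathcomp Require Import ring.
From mathcomp Require Import boolp classical_sets.

(**
  Identify e_i with t^(i+1) d/dt.  The derivations of L_1 are exactly the
  brackets [twder q] with the vector fields q(t) t d/dt, where q is any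
  polynomial: evaluating a derivation D on [e_2, e_3] = e_5 = [e_1, e_4] / 3
  gives an Euler differential equation for D e_1 and D e_2, whose only
  polynomial solutions come from such a q.

  If q t d/dt is bracketed with a vector field having a double zero at a, the
  result vanishes at a.  Hence for a local derivation Delta, the value of
  Delta x at a depends only on the 1-jet of x at a, so that Delta is a
  differential operator of order at most one.  Subtracting a suitable
  [twder B] leaves the multiplication by some polynomial C, and testing this
  on X - a yields C(a) = 0 for all nonzero a.
*)

Set Implicit Arguments.
Unset Strict Implicit.
Unset Printing Implicit Defensive.

Import GRing.Theory.
Local Open Scope ring_scope.

(** In characteristic zero the positive integers are infinitely many distinct points. Zero is left
    out because [local_twder] cancels the point a. *)
Lemma poly_eq0_natr (F : fieldType) (p : {poly F}) :
  [pchar F] =i pred0 -> (forall n, (0 < n)%N -> p.[n%:R] = 0) -> p = 0.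
Proof.
move=> /pcharf0P F0 p0; apply/eqP; apply: contraT => nz_p.
have inj_natr : injective (fun n : nat => n%:R : F).
  suff le_inj m n : (m <= n)%N -> m%:R = n%:R :> F -> m = n.
    by move=> m n mn; case/orP: (leq_total m n) => /le_inj ->.
  move=> le_mn /eqP; rewrite eq_sym -subr_eq0 -natrB // F0 subn_eq0 => le_nm.
  by apply/eqP; rewrite eqn_leq le_mn.
have := @max_poly_roots F p [seq n%:R | n <- iota 1 (size p)] nz_p.
rewrite size_map size_iota ltnn => -> //;
  last by rewrite map_inj_uniq ?iota_uniq.
apply/allP => _ /mapP[n + ->]; rewrite mem_iota => /andP[n_gt0 _].
exact/rootP/p0.
Qed.

Lemma poly_taylor2 (F : fieldType) (p : {poly F}) (a : F) :
  exists r, p = p.[a]%:A + p^`().[a] *: ('X - a%:A) + r * ('X - a%:P) ^+ 2.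
Proof.
have /factor_theorem[s ps] : root (p - p.[a]%:P) a.
  by rewrite /root !hornerE subrr.
have /factor_theorem[r sr] : root (s - s.[a]%:P) a.
  by rewrite /root !hornerE subrr.
have -> : p^`().[a] = s.[a].
  by rewrite -[p](subrK p.[a]%:P) ps !derivE !hornerE /=; ring.
exists r; rewrite !alg_polyC; move/eqP: ps; rewrite subr_eq addrC => /eqP {1}->.
move/eqP: sr; rewrite subr_eq => /eqP {1}->.
by rewrite -mul_polyC; ring.
Qed.

(** The k-th coefficient of the equation is (k (k - 1) + 6) v_k, and k (k - 1) + 6 is a positive
    integer. *)
Lemma euler_eq0 (F : fieldType) (v : {poly F}) :
  [pchar F] =i pred0 -> 'X^2 * v^`()^`() + 6%:R * v = 0 -> v = 0.
Proof.
move=> /pcharf0P F0 vE; apply/polyP => k; rewrite coef0.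
have /eqP := congr1 (fun p : {poly F} => p`_k) vE.
rewrite coef0 coefD coefXnM -polyC_natr coefCM.
case: k => [|[|k]] /=.
- by rewrite add0r mulf_eq0 F0 => /eqP.
- by rewrite add0r mulf_eq0 F0 => /eqP.
rewrite !subSS subn0 !coef_deriv -mulrnA -[_ *+ _]mulr_natl -mulrDl -natrD.
by rewrite mulf_eq0 F0 addn_eq0 andbF => /eqP.
Qed.

Section TwistedDerivation.
Variable F : fieldType.
Implicit Types p q x y : {poly F}.

(* [q t d/dt, x t^2 d/dt] = (twder q x) t^2 d/dt *)
Definition twder q x : {poly F} := q * ('X * x)^`() - q^`() * ('X * x).

Lemma twder_linear q : linear (twder q).
Proof. by move=> c x y; rewrite /twder !derivE -!mul_polyC; ring. Qed.

HB.instance Definition _ q :=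
  GRing.isLinear.Build F {poly F} {poly F} _ (twder q) (twder_linear q).

Lemma twderBl p q x : twder (p - q) x = twder p x - twder q x.
Proof. by rewrite /twder derivB; ring. Qed.

Lemma twder_double_root q x a : (twder q (x * ('X - a%:P) ^+ 2)).[a] = 0.
Proof. by rewrite /twder !derivCE !hornerE subrr /=; ring. Qed.

Lemma linear_poly_eq (f g : {linear {poly F} -> {poly F}}) :
  (forall n, f 'X^n = g 'X^n) -> f =1 g.
Proof.
move=> fg p; rewrite -[p]coefK poly_def !linear_sum /=.
by apply: eq_bigr => i _; rewrite !linearZ fg.
Qed.

Definition poly_derivation (f : {poly F} -> {poly F}) :=
  forall x y, f (L1bracket x y) = L1bracket (f x) y + L1bracket x (f y).

Lemma twder_derivation q : poly_derivation (twder q).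
Proof. by move=> x y; rewrite !L1bracketE /twder !derivE; ring. Qed.

(** The vectors e_1 = [1] and e_2 = ['X] generate L_1, since [e_1, e_m] = (m - 1) e_(m+1). *)
Lemma poly_derivation_eq (f g : {linear {poly F} -> {poly F}}) :
    [pchar F] =i pred0 -> poly_derivation f -> poly_derivation g ->
  f 1 = g 1 -> f 'X = g 'X -> f =1 g.
Proof.
move=> /pcharf0P F0 derf derg fg1 fgX; apply: linear_poly_eq.
elim=> [|[|n] IHn] //; have nz_n : n.+1%:R != 0 :> F by rewrite F0.
apply: (scalerI nz_n); rewrite -!linearZ.
suff -> : n.+1%:R *: 'X^(n.+2) = L1bracket 1 ('X^(n.+1)) :> {poly F}.
  by rewrite derf derg fg1 IHn.
by rewrite L1bracketE !derivE scaler_nat -mulr_natr !exprS -mulr_natr /=; ring.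
Qed.

(* The degree 5 relation [e_2, e_3] = [e_1, [e_1, [e_1, e_2]]] / 6. *)
Lemma poly_derivation_euler (D : {linear {poly F} -> {poly F}})
    (v := 'X * D 1 *+ 2 - D 'X *+ 2 + 'X * (D 'X)^`() - 'X^2 * (D 1)^`()) :
  poly_derivation D -> 'X^2 * v^`()^`() + 6%:R * v = 0.
Proof.
move=> derD.
have D2 : D 'X^2 = L1bracket (D 1) 'X + L1bracket 1 (D 'X).
  by rewrite -derD; congr (D _); rewrite L1bracketE !derivE; ring.
have D3 : D 'X^3 *+ 2 = L1bracket (D 1) 'X^2 + L1bracket 1 (D 'X^2).
  by rewrite -derD -linearMn; congr (D _); rewrite L1bracketE !derivE /=; ring.
have D4 : D 'X^4 *+ 3 = L1bracket (D 1) 'X^3 + L1bracket 1 (D 'X^3).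
  by rewrite -derD -linearMn; congr (D _); rewrite L1bracketE !derivE /=; ring.
have D4' : D 'X^4 = L1bracket (D 'X) 'X^2 + L1bracket 'X (D 'X^2).
  by rewrite -derD; congr (D _); rewrite L1bracketE !derivE /=; ring.
have {D3} D3' := congr1 (@deriv F) D3; rewrite derivMn in D3'.
have X3_neq0 : 'X^3 != 0 :> {poly F} by rewrite expf_neq0 ?polyX_eq0.
apply: (mulfI X3_neq0); rewrite mulr0.
(* This difference vanishes by [D4]; rewriting its last term by [D4'] instead turns it into X^3
   times the Euler expression. *)
transitivity ((L1bracket (D 1) 'X^3 + L1bracket 1 (D 'X^3)) *+ 2 - D 'X^4 *+ 6).
  rewrite D4' L1bracketE.
  have -> : L1bracket 1 (D 'X^3) = 'X^2 * (D 'X^3)^`().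
    by rewrite L1bracketE !derivE; ring.
  rewrite mulrnDl -['X^2 * (D 'X^3)^`() *+ 2]mulrnAr D3' D2 /v.
  by rewrite !L1bracketE !derivE /=; ring.
by rewrite -D4; ring.
Qed.

Lemma poly_derivation_twder (D : {linear {poly F} -> {poly F}}) :
  [pchar F] =i pred0 -> poly_derivation D -> exists q, D =1 twder q.
Proof.
move=> F0 derD; have := euler_eq0 F0 (poly_derivation_euler derD).
have nz2 : 2%:R != 0 :> F by move/pcharf0P: F0 => ->.
set a := D 1; set v := (X in X = 0 -> _) => v0.
have /factor_theorem[b Db] : root (D 'X) 0.
  apply/rootP/(mulfI nz2); transitivity (- v.[0]).
    by rewrite !hornerE /=; ring.
  by rewrite v0 horner0 oppr0 mulr0.
rewrite /v Db subr0 !derivE in v0.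
have {}v0 : a *+ 2 - b + 'X * b^`() - 'X * a^`() = 0.
  by apply: (mulfI (negbT (polyX_eq0 F))); rewrite mulr0 -[RHS]v0; ring.
(* If D = [twder q], then a = q - X q' and b = 2 q - X q', which forces q = b - a; conversely [v0]
   makes this q work. *)
exists (b - a); apply: poly_derivation_eq => //; first exact: twder_derivation.
  by rewrite -[LHS]subr0 -v0 /= /twder !derivE -/a; ring.
by rewrite -[LHS]subr0 -(mulr0 'X) -v0 Db /= /twder subr0 !derivE; ring.
Qed.

Section LocalDerivation.
Variable Delta : {linear {poly F} -> {poly F}}.
Hypothesis F0 : [pchar F] =i pred0.
Hypothesis locD : forall x, exists q, Delta x = twder q x.

Lemma local_order1 x :
  Delta x = x * Delta 1 + x^`() * (Delta 'X - 'X * Delta 1).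
Proof.
apply/eqP; rewrite -subr_eq0; apply/eqP/poly_eq0_natr => // n _.
have [r xE] := poly_taylor2 x n%:R.
rewrite {1}xE !(linearD, linearN, linearZ) /=.
(* Whatever q is, the Taylor remainder contributes 0 at n; the linear part gives the right side
   there. *)
have [q ->] := locD (r * ('X - n%:R%:P) ^+ 2).
by rewrite 3!hornerD twder_double_root !hornerE /=; ring.
Qed.

Lemma local_twder : exists q, Delta =1 twder q.
Proof.
have [q0 DX] := locD 'X.
have /factor_theorem[B DB] : root (Delta 'X - 'X * Delta 1) 0.
  by apply/rootP; rewrite DX /twder !derivE !hornerE /=; ring.
rewrite subr0 in DB.
(* As [twder B] maps x to (B - X B') x + X B x', it has the same first-order coefficient as [Delta],
   and [C] is the difference of the zeroth-order ones. *)
pose C := Delta 1 - B + 'X * B^`().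
have DeltaE x : Delta x = twder B x + x * C.
  by rewrite local_order1 DB /twder /C !derivE; ring.
suff C0 : C = 0 by exists B => x; rewrite DeltaE C0 mulr0 addr0.
apply: poly_eq0_natr => // n n_gt0; set a : F := n%:R.
have nz_a : a != 0 by move/pcharf0P: F0 => ->; rewrite -lt0n.
have [q qC] : exists q, ('X - a%:P) * C = twder q ('X - a%:P).
  have [q1 DeltaXa] := locD ('X - a%:P); exists (q1 - B).
  by rewrite twderBl -DeltaXa DeltaE addrAC subrr add0r.
have qa0 : q.[a] = 0.
  apply: (mulfI nz_a); transitivity (twder q ('X - a%:P)).[a].
    by rewrite /twder !derivE !hornerE /=; ring.
  by rewrite -qC !hornerE subrr; ring.
(* With y = X - a, the derivative of [twder q y] is q (X y)'' - q'' X y, and both q and y vanish at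
   a. *)
transitivity (('X - a%:P) * C)^`().[a].
  by rewrite !derivE !hornerE /=; ring.
by rewrite qC /twder !derivE !hornerE /= qa0; ring.
Qed.
End LocalDerivation.
End TwistedDerivation.

Theorem theorem3p3 (F : closedFieldType) (charF0 : [pchar F] =i pred0) :
  LDer (L1 F) = BLDer (L1 F) /\ BLDer (L1 F) = Der (L1 F).
Proof.
have BLDer_LDer : (BLDer (L1 F) `<=` LDer (L1 F))%classic.
  by move=> f f2 x; have [D [derD fx _]] := f2 x x; exists D.
have Der_BLDer : (Der (L1 F) `<=` BLDer (L1 F))%classic.
  by move=> f derf x y; exists f.
have LDer_Der : (LDer (L1 F) `<=` Der (L1 F))%classic.
  move=> f locf; have [|q fE] := @local_twder F f charF0.
    move=> x; have [D [derD ->]] := locf x.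
    by have [q ->] := @poly_derivation_twder F D charF0 derD; exists q.
  by move=> x y; rewrite !fE; apply: twder_derivation.
split; apply/seteqP; split=> // f.
- by move/LDer_Der/Der_BLDer.
- by move/BLDer_LDer/LDer_Der.
Qed.
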